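(* Let $p,q,r\in\{2,3,\ldots\}\cup\{\infty\}$ be such that the triangle group $\Delta(p,q,r)$ is infinite, and let $\mathrm{cc}_2$ denote the number of conjugacy classes of involutions. If $p,q,r$ are all finite, then $$\mathrm{cc}_2(\Delta(p,q,r))=\begin{cases}6,&\text{if }p,q,r\text{ are all even},\\ 1,&\text{if }p,q,r\text{ are all odd},\\ 4,&\text{if precisely one of }p,q,r\text{ is odd},\\ 2,&\text{if precisely one of }p,q,r\text{ is even}.\end{cases}$$ If $q,r$ are finite, then $$\mathrm{cc}_2(\Delta(\infty,q,r))=\begin{cases}5,&\text{if }q\text{ and }r\text{ are even},\\ 1,&\text{if }q\text{ and }r\text{ are odd},\\ 3,&\text{if }q+r\text{ is odd}.\end{cases}$$ If $r$ is finite, then $$\mathrm{cc}_2(\Delta(\infty,\infty,r))=\begin{cases}4,&\text{if }r\text{ is even},\\ 2,&\text{if }r\text{ is odd}.\end{cases}$$ Finally, $\mathrm{cc}_2(\Delta(\infty,\infty,\infty))=3$.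
   Context: For $p,q,r\in\{2,3,\ldots\}\cup\{\infty\}$, the triangle group is $\Delta(p,q,r)=\langle s_1,s_2,s_3\mid s_1^2,s_2^2,s_3^2,(s_1s_2)^p,(s_1s_3)^q,(s_2s_3)^r\rangle$, where a relation with exponent $\infty$ is omitted. It is infinite if and only if at least one of $p,q,r$ is $\infty$ or $\frac1p+\frac1q+\frac1r\le1$. An involution is an element of order exactly $2$. *)

(* Defs.v *)
From HB Require Import structures.
From mathcomp Require Import all_boot.
From mathcomp Require Import boolp classical_sets functions cardinality.

Set Implicit Arguments.
Unset Strict Implicit.
Unset Printing Implicit Defensive.

Local Open Scope classical_set_scope.
Local Open Scope quotient_scope.

(* The letter (x, true) is the generator x, and (x, false) is its inverse. *)
Notation word X := (seq (X * bool)).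

Definition word_gen (X : Type) (x : X) : word X := [:: (x, true)].

Definition word_inv (X : Type) (w : word X) : word X :=
  rev [seq (a.1, ~~ a.2) | a <- w].

Definition word_exp (X : Type) (w : word X) (n : nat) : word X :=
  flatten (nseq n w).

(* Equality in < X | R >: the least congruence on words that contains the
   free reductions and identifies every relator with the empty word. *)
Inductive pres_eq (X : Type) (R : set (word X)) : word X -> word X -> Prop :=
| pres_eq_refl u : pres_eq R u u
| pres_eq_sym u v : pres_eq R u v -> pres_eq R v u
| pres_eq_trans v u w : pres_eq R u v -> pres_eq R v w -> pres_eq R u w
| pres_eq_cat u u' v v' :
    pres_eq R u u' -> pres_eq R v v' -> pres_eq R (u ++ v) (u' ++ v')
| pres_eq_free x b : pres_eq R [:: (x, b); (x, ~~ b)] [::]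
| pres_eq_rel w : R w -> pres_eq R w [::].

Section Presentation.
Variables (X : choiceType) (R : set (word X)).

Lemma word_invK : involutive (@word_inv X).
Proof.
move=> w; rewrite /word_inv map_rev revK -map_comp -[RHS]map_id.
by apply: eq_map => -[x b] /=; rewrite negbK.
Qed.

Lemma pres_eq_mulVw (w : word X) : pres_eq R (word_inv w ++ w) [::].
Proof.
elim: w => [|[x b] w IHw]; first exact: pres_eq_refl.
rewrite /word_inv /= rev_cons cat_rcons -/(word_inv w).
apply: pres_eq_trans IHw; apply: pres_eq_cat; first exact: pres_eq_refl.
rewrite -[w in X in pres_eq _ _ X]cat0s.
apply: (pres_eq_cat (u := [:: _; _])); last exact: pres_eq_refl.
by have := pres_eq_free R x (~~ b); rewrite negbK.
Qed.

Lemma pres_eq_mulwV (w : word X) : pres_eq R (w ++ word_inv w) [::].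
Proof. by have := pres_eq_mulVw (word_inv w); rewrite word_invK. Qed.

Lemma pres_eq_inv (u v : word X) :
  pres_eq R u v -> pres_eq R (word_inv u) (word_inv v).
Proof.
move=> uv; apply: (@pres_eq_trans _ _ (word_inv u ++ (v ++ word_inv v))).
  rewrite -[X in pres_eq _ X _]cats0.
  by apply: pres_eq_cat (pres_eq_refl _ _) (pres_eq_sym (pres_eq_mulwV v)).
rewrite catA -[X in pres_eq _ _ X]cat0s.
apply: pres_eq_cat (pres_eq_refl _ _).
apply: pres_eq_trans (pres_eq_mulVw u).
exact: pres_eq_cat (pres_eq_refl _ _) (pres_eq_sym uv).
Qed.

Definition pres_rel : rel (word X) := fun u v => `[< pres_eq R u v >].

Fact pres_rel_refl : reflexive pres_rel.
Proof. by move=> u; apply/asboolP; exact: pres_eq_refl. Qed.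

Fact pres_rel_sym : symmetric pres_rel.
Proof. by move=> u v; apply/asboolP/asboolP; exact: pres_eq_sym. Qed.

Fact pres_rel_trans : transitive pres_rel.
Proof.
by move=> v u w /asboolP uv /asboolP vw; apply/asboolP; exact: pres_eq_trans vw.
Qed.

Definition pres_equiv : equiv_rel (word X) :=
  EquivRel pres_rel pres_rel_refl pres_rel_sym pres_rel_trans.

Definition presented_group : Type := {eq_quot pres_equiv}.

HB.instance Definition _ := Choice.on presented_group.
HB.instance Definition _ := EqQuotient.on presented_group.

Definition pres_class (w : word X) : presented_group := \pi_presented_group w.

Lemma pres_classP (u v : word X) : pres_class u = pres_class v <-> pres_eq R u v.
Proof.
split=> [/eqquotP/asboolP //|uv].
by apply/eqquotP/asboolP.
Qed.

Lemma pres_class_repr (x : presented_group) : pres_class (repr x) = x.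
Proof. exact: reprK. Qed.

Lemma pres_repr_class (w : word X) : pres_eq R (repr (pres_class w)) w.
Proof. by apply/pres_classP; exact: pres_class_repr. Qed.

Definition pres_one : presented_group := pres_class [::].
Definition pres_mul (x y : presented_group) : presented_group :=
  pres_class (repr x ++ repr y).
Definition pres_inv (x : presented_group) : presented_group :=
  pres_class (word_inv (repr x)).

Lemma pres_mulE (u v : word X) :
  pres_mul (pres_class u) (pres_class v) = pres_class (u ++ v).
Proof. by apply/pres_classP/pres_eq_cat; exact: pres_repr_class. Qed.

Lemma pres_invE (w : word X) : pres_inv (pres_class w) = pres_class (word_inv w).
Proof. by apply/pres_classP/pres_eq_inv; exact: pres_repr_class. Qed.

Fact pres_mulA : associative pres_mul.
Proof.
move=> x y z; rewrite -(pres_class_repr x) -(pres_class_repr y).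
by rewrite -(pres_class_repr z) !pres_mulE catA.
Qed.

Fact pres_mul1g : left_id pres_one pres_mul.
Proof. by move=> x; rewrite -(pres_class_repr x) pres_mulE. Qed.

Fact pres_mulg1 : right_id pres_one pres_mul.
Proof. by move=> x; rewrite -(pres_class_repr x) pres_mulE cats0. Qed.

Fact pres_mulVg : left_inverse pres_one pres_inv pres_mul.
Proof.
move=> x; rewrite -(pres_class_repr x) pres_invE pres_mulE.
by apply/pres_classP; exact: pres_eq_mulVw.
Qed.

Fact pres_mulgV : right_inverse pres_one pres_inv pres_mul.
Proof.
move=> x; rewrite -(pres_class_repr x) pres_invE pres_mulE.
by apply/pres_classP; exact: pres_eq_mulwV.
Qed.

HB.instance Definition _ := isGroup.Build presented_group
  pres_mulA pres_mul1g pres_mulg1 pres_mulVg pres_mulgV.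

End Presentation.

(* Exponents range over {2, 3, ...} together with infinity, which is None. *)
Definition is_exponent (m : option nat) : Prop :=
  if m is Some n then 1 < n else True.

Definition triangle_gen1 : word 'I_3 := word_gen (@Ordinal 3 0 isT).
Definition triangle_gen2 : word 'I_3 := word_gen (@Ordinal 3 1 isT).
Definition triangle_gen3 : word 'I_3 := word_gen (@Ordinal 3 2 isT).

Definition power_relators (X : Type) (w : word X) (m : option nat) :
    seq (word X) :=
  if m is Some n then [:: word_exp w n] else [::].

Definition triangle_relators (p q r : option nat) : seq (word 'I_3) :=
  [:: word_exp triangle_gen1 2; word_exp triangle_gen2 2;
      word_exp triangle_gen3 2]
  ++ power_relators (triangle_gen1 ++ triangle_gen2) p
  ++ power_relators (triangle_gen1 ++ triangle_gen3) q
  ++ power_relators (triangle_gen2 ++ triangle_gen3) r.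

Definition triangle_group (p q r : option nat) : groupType :=
  presented_group [set` triangle_relators p q r].

Section Involutions.
Variable G : groupType.
Local Open Scope group_scope.

Definition involution (x : G) : Prop := x <> 1 /\ x ^+ 2 = 1.

Definition conj_class (x : G) : set G := [set x ^ g | g in [set: G]].

Definition involution_classes : set (set G) :=
  [set conj_class x | x in involution].

End Involutions.

Arguments involution_classes : clear implicits.

(* The number of conjugacy classes of involutions of G is the (finite)
   number n. *)
Definition cc2_is (G : groupType) (n : nat) : Prop :=
  (involution_classes G #= `I_n)%card.

(* Main.v *)
From HB Require Import structures.
Require Import Defs.
From mathcomp Require Import all_boot all_order all_algebra.
From mathcomp Require Import boolp classical_sets functions cardinality.
From mathcomp Require Import Rstruct reals trigo.
From mathcomp Require Import ring lra zify.

(* Let W be the Coxeter group acting on its geometric representation, in which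
   w(alpha_i) has nonnegative or nonpositive coordinates according to whether
   w s_i is longer or shorter than w (Humphreys, Reflection Groups and Coxeter
   Groups, 5.4). An involution x of minimal length in its conjugacy class
   satisfies x(alpha_i) = - alpha_i for every right descent i, and then x lies
   in the parabolic subgroup generated by its descents (Richardson). If every
   generator were a descent, x would map all positive roots to negative ones
   and W would be finite; so for the infinite triangle group x lies in a proper
   parabolic subgroup, which is dihedral, and is conjugate to a generator or to
   a half turn (s_i s_j)^(m_ij / 2).

   Generators are separated by characters to Z/2, up to the odd edges, and
   generators are separated from half turns by the sign. If g conjugates the
   half turn fixing one vertex to the half turn fixing another one and has
   minimal length, then g is positive on the two simple roots negated by the
   first half turn x; either g = 1, or g x maps every simple root to a negative
   root, contradicting that W is infinite. *)

Set Implicit Arguments.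
Unset Strict Implicit.
Unset Printing Implicit Defensive.

Import Order.TTheory GRing.Theory Num.Theory.
Local Open Scope classical_set_scope.

(** * Chebyshev values at [2 cos (pi / m)] *)

Section ChebyshevCoefficients.
Local Open Scope ring_scope.
Variable R : realType.
(** The pair carries two consecutive terms of the recurrence. [chebU d k] is the Chebyshev
    polynomial of the second kind of degree [k - 1] at [d / 2], that is [sin (k t) / sin t] when
    [d = 2 cos t]. *)
Fixpoint chebU2 (d : R) (k : nat) : R * R :=
  if k is k'.+1 then let: (a, b) := chebU2 d k' in (b, d * b - a) else (0, 1).
Definition chebU d k := (chebU2 d k).1.

Lemma chebU0 d : chebU d 0 = 0. Proof. by []. Qed.
Lemma chebU1 d : chebU d 1 = 1. Proof. by []. Qed.
Lemma chebUSS d k : chebU d k.+2 = d * chebU d k.+1 - chebU d k.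
Proof. by rewrite /chebU /=; case: (chebU2 d k). Qed.

(* [m = 0] stands for the exponent infinity. At [m = 1] the value is [- 2], so
   [- cox_coef (m i j)] is the Cartan matrix on the diagonal too. *)
Definition cox_coef (m : nat) : R := if m is 0 then 2 else 2 * cos (pi / m%:R).

Lemma cox_coef1 : cox_coef 1 = - 2.
Proof. by rewrite /cox_coef divr1 cospi mulrN1. Qed.

Lemma chebU_cox0 k : chebU (cox_coef 0) k = k%:R.
Proof.
suff [] : chebU (cox_coef 0) k = k%:R /\ chebU (cox_coef 0) k.+1 = k.+1%:R by [].
elim: k => [|k [IH1 IH2]]; first by [].
by split=> //; rewrite chebUSS IH1 IH2 /cox_coef -!natr1; ring.
Qed.

Lemma chebU_sin m k : (0 < m)%N ->
  chebU (cox_coef m) k * sin (pi / m%:R) = sin (k%:R * (pi / m%:R)).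
Proof.
case: m => // m _; set t := pi / _.
suff [] : chebU (cox_coef m.+1) k * sin t = sin (k%:R * t) /\
  chebU (cox_coef m.+1) k.+1 * sin t = sin (k.+1%:R * t) by [].
elim: k => [|k [IH1 IH2]].
  by rewrite chebU0 chebU1 !mul0r !mul1r sin0.
split=> //; rewrite chebUSS mulrBl -mulrA IH1 IH2 /cox_coef -/t.
have -> : k.+2%:R * t = k.+1%:R * t + t by rewrite -natr1 mulrDl mul1r.
have -> : k%:R * t = k.+1%:R * t - t by rewrite -natr1 mulrDl mul1r addrK.
by rewrite sinB sinD; ring.
Qed.

Lemma cox_sin_gt0 m : (1 < m)%N -> 0 < sin (pi / m%:R) :> R.
Proof.
move=> m1; have m0 : (0 : R) < m%:R by rewrite ltr0n; lia.
apply: sin_gt0_pi; rewrite divr_gt0 ?pi_gt0 //= ltr_pdivrMr // ltr_pMr ?pi_gt0 //.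
by rewrite ltr1n.
Qed.

(** For finite [m] the angle [k pi / m] lies strictly between 0 and [pi]; in the infinite case the
    value is [k]. *)
Lemma chebU_gt0 (m k : nat) : m != 1%N -> (0 < k)%N -> (m == 0)%N || (k < m)%N ->
  0 < chebU (cox_coef m) k.
Proof.
move=> m1 k0 /orP[/eqP ->|km]; first by rewrite chebU_cox0 ltr0n.
have m2 : (1 < m)%N by lia.
have m3 : (0 < m)%N by lia.
have m0 : (0 : R) < m%:R by rewrite ltr0n; lia.
rewrite -(pmulr_lgt0 _ (cox_sin_gt0 m2)) (chebU_sin _ (ltnW m2)).
apply: sin_gt0_pi; rewrite mulr_gt0 ?divr_gt0 ?pi_gt0 ?ltr0n //=.
by rewrite mulrCA gtr_pMr ?pi_gt0 // ltr_pdivrMr // mul1r ltr_nat.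
Qed.

Lemma cox_angle m : (0 < m)%N -> m%:R * (pi / m%:R) = pi :> R.
Proof. by move=> m0; rewrite mulrC divfK // pnatr_eq0; lia. Qed.

Lemma chebU_period m : (1 < m)%N -> chebU (cox_coef m) m = 0.
Proof.
move=> m1; have := chebU_sin m (ltnW m1).
rewrite cox_angle ?sinpi; last exact: ltnW.
by move/eqP; rewrite mulf_eq0 (gt_eqF (cox_sin_gt0 m1)) orbF => /eqP.
Qed.

Lemma chebU_periodS m : (1 < m)%N -> chebU (cox_coef m) m.+1 = -1.
Proof.
move=> m1; have := chebU_sin m.+1 (ltnW m1).
rewrite -natr1 [(_ + 1) * _]mulrDl mul1r cox_angle; last exact: ltnW.
rewrite addrC sinDpi -mulN1r.
by move/mulIf; apply; rewrite (gt_eqF (cox_sin_gt0 m1)).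
Qed.

Lemma chebUD_period m k : (1 < m)%N ->
  chebU (cox_coef m) (m + k) = - chebU (cox_coef m) k.
Proof.
move=> m1; set d := cox_coef m.
suff [] : chebU d (m + k) = - chebU d k /\ chebU d (m + k.+1) = - chebU d k.+1 by [].
elim: k => [|k [IH1 IH2]].
  by rewrite addn0 addn1 chebU0 chebU1 oppr0 chebU_period ?chebU_periodS.
split=> //; rewrite !addnS chebUSS -!addnS IH1 IH2 chebUSS; ring.
Qed.

(** [4 - cox_coef m ^+ 2 = 4 sin^2 (pi / m) > 0] is the determinant of the rank 2 Cartan matrix, so
    the form is nondegenerate on the plane of a finite edge. *)
Lemma cox_coef_sqr m : (1 < m)%N -> cox_coef m ^+ 2 != 4.
Proof.
case: m => // m m1; have s0 := cox_sin_gt0 m1.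
have : 0 < sin (pi / m.+1%:R) ^+ 2 :> R by rewrite exprn_gt0.
rewrite /cox_coef sin2cos2 => h; rewrite lt_eqF //; nra.
Qed.

End ChebyshevCoefficients.

(** * Coxeter matrices and Coxeter systems *)

Definition coxeter_matrix (n : nat) (m : 'I_n -> 'I_n -> nat) : Prop :=
  [/\ forall i, m i i = 1%N, forall i j, m i j = m j i
    & forall i j, i != j -> m i j != 1%N].

(* The universal property is stated for maps to monoids: the generators are
   involutions since [m i i = 1], so it involves no inverses. *)
Definition coxeter_system (n : nat) (W : groupType) (s : 'I_n -> W)
    (m : 'I_n -> 'I_n -> nat) : Prop :=
  [/\ forall i j, ((s i * s j) ^+ m i j = 1)%g,
      forall x, exists l : seq 'I_n, x = (\prod_(i <- l) s i)%g
    & forall (T : Type) (idx : T) (op : T -> T -> T) (f : 'I_n -> T),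
        associative op -> left_id idx op -> right_id idx op ->
        (forall i j, iter (m i j) (op (op (f i) (f j))) idx = idx) ->
        exists phi : W -> T, [/\ phi 1%g = idx,
          forall x y, phi (x * y)%g = op (phi x) (phi y)
        & forall i, phi (s i) = f i]].

(** * The reflection representation *)

Section GeometricRepresentation.
Local Open Scope ring_scope.
Variables (R : realType) (n : nat) (m : 'I_n -> 'I_n -> nat).
Hypothesis m_cox : coxeter_matrix m.

Let m_diag i : m i i = 1%N. Proof. by case: m_cox. Qed.
Let m_sym i j : m i j = m j i. Proof. by case: m_cox. Qed.
Let m_neq1 i j : i != j -> m i j != 1%N. Proof. by case: m_cox => _ _; exact. Qed.

Definition cartan : 'M[R]_n := \matrix_(i, j) - cox_coef R (m i j).
Definition simple_root (i : 'I_n) : 'cV[R]_n := delta_mx i 0.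
Definition reflection (i : 'I_n) : 'M[R]_n := 1%:M - delta_mx i i *m cartan.

Local Notation alpha := simple_root.
Local Notation d := (cox_coef R).
Local Notation U i j := (chebU (d (m i j))).

Lemma reflection_mul i (v : 'cV[R]_n) :
  reflection i *m v = v - ((cartan *m v) i 0) *: alpha i.
Proof.
rewrite mulmxBl mul1mx -mulmxA; congr (_ - _); apply/colP => k.
rewrite !mxE (bigD1 i) //= big1 ?addr0 => [|j ji].
  by rewrite !mxE !eqxx !andbT mulrC.
by rewrite mxE (negbTE ji) andbF mul0r.
Qed.

Lemma cartan_root i j : (cartan *m alpha j) i 0 = - d (m i j).
Proof. by rewrite -colE !mxE. Qed.

Lemma reflection_root i j :
  reflection i *m alpha j = alpha j + d (m i j) *: alpha i.
Proof. by rewrite reflection_mul cartan_root scaleNr opprK. Qed.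

Lemma reflection_rootii i : reflection i *m alpha i = - alpha i.
Proof.
rewrite reflection_root m_diag cox_coef1 scaleNr -[X in X - _]scale1r.
by rewrite -scalerBl -[RHS]scaleN1r; congr (_ *: _); ring.
Qed.

Lemma mx_ext (M N : 'M[R]_n) : (forall v : 'cV_n, M *m v = N *m v) -> M = N.
Proof.
move=> h; apply/matrixP => a b.
have := congr1 (fun M : 'cV_n => M a 0) (h (delta_mx b 0)).
by rewrite -!colE !mxE.
Qed.

Lemma reflectionK i : reflection i *m reflection i = 1%:M.
Proof.
apply: mx_ext => v; rewrite mul1mx -mulmxA.
rewrite [reflection i *m v]reflection_mul mulmxBr reflection_mul -scalemxAr.
by rewrite reflection_rootii scalerN opprK subrK.
Qed.

Lemma iter_mulmx k (M : 'M[R]_n) (v : 'cV_n) :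
  iter k (mulmx M) 1%:M *m v = iter k (mulmx M) v.
Proof. by elim: k => [|k IH] /=; rewrite ?mul1mx // -mulmxA IH. Qed.

(** By the Chebyshev recurrence each reflection replaces the older of the two coefficients by the
    next one. The offset [K] allows the start at [alpha i] ([K = 0]) or at a vector involving
    [alpha j] ([K = 1]). *)
Lemma rotation_cheb i j k K :
  iter k (mulmx (reflection i *m reflection j))
    (U i j K.+1 *: alpha i + U i j K *: alpha j) =
  U i j (k.*2 + K).+1 *: alpha i + U i j (k.*2 + K)%N *: alpha j.
Proof.
elim: k => [|k IH] //=; rewrite {}IH.
set L := (k.*2 + K)%N; rewrite -mulmxA.
have -> : reflection j *m (U i j L.+1 *: alpha i + U i j L *: alpha j) =
    U i j L.+1 *: alpha i + U i j L.+2 *: alpha j.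
  rewrite mulmxDr -!scalemxAr reflection_rootii reflection_root (m_sym j i).
  rewrite chebUSS scalerDr scalerN scalerA scalerBl -addrA.
  by rewrite [_ * d _]mulrC.
rewrite mulmxDr -!scalemxAr reflection_rootii reflection_root.
rewrite [U i j L.+3]chebUSS scalerDr scalerN scalerA scalerBl.
by rewrite [U i j L.+2 * _]mulrC addrC -addrA addrC.
Qed.

Lemma reflection_braid i j :
  iter (m i j) (mulmx (reflection i *m reflection j)) 1%:M = 1%:M.
Proof.
have [<-|ij] := eqVneq i j; first by rewrite m_diag /= mulmx1 reflectionK.
have [-> //|m0] := eqVneq (m i j) 0%N.
have m1 : (1 < m i j)%N by have := m_neq1 ij; lia.
apply: mx_ext => v; rewrite mul1mx.
set P := reflection i *m reflection j; set Pm := iter _ _ _.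
(* A shift by [m i j] changes the sign, so twice that is a period. *)
have per k : U i j ((m i j).*2 + k) = U i j k.
  by rewrite -addnn -addnA !chebUD_period // opprK.
have Pi : Pm *m alpha i = alpha i.
  have := rotation_cheb i j (m i j) 0; rewrite -/P -iter_mulmx -/Pm -addnS !per.
  by rewrite chebU0 chebU1 scale1r scale0r addr0.
have Pj : Pm *m alpha j = alpha j.
  have := rotation_cheb i j (m i j) 1; rewrite -/P -iter_mulmx -/Pm -addnS !per.
  by rewrite mulmxDr -!scalemxAr Pi chebU1 !scale1r => /addrI.
(* [a] and [b] solve the 2 by 2 system, of determinant [D], that makes [v'] orthogonal to [alpha i]
   and [alpha j]. Both reflections fix [v'], and the rotation is already known on the plane. *)
pose p := (cartan *m v) i 0; pose q := (cartan *m v) j 0; pose D := 4 - d (m i j) ^+ 2.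
have D0 : D != 0 by rewrite subr_eq0 eq_sym cox_coef_sqr.
pose a := (2 * p + d (m i j) * q) / D; pose b := (2 * q + d (m i j) * p) / D.
pose v' := v - a *: alpha i - b *: alpha j.
have cv' k : (cartan *m v') k 0 =
    (cartan *m v) k 0 + a * d (m k i) + b * d (m k j).
  rewrite !mulmxBr -!scalemxAr !mxE.
  have := cartan_root k i; have := cartan_root k j.
  by rewrite !mxE => -> ->; ring.
have ci : (cartan *m v') i 0 = 0.
  by rewrite cv' m_diag cox_coef1 -/p /a /b; move: D0; rewrite /D => D0; field.
have cj : (cartan *m v') j 0 = 0.
  rewrite cv' m_diag cox_coef1 (m_sym j i) -/q /a /b.
  by move: D0; rewrite /D => D0; field.
have Pv' : P *m v' = v'.
  rewrite /P -mulmxA [reflection j *m _]reflection_mul cj scale0r subr0.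
  by rewrite reflection_mul ci scale0r subr0.
have Pmv' : Pm *m v' = v' by rewrite iter_mulmx; elim: (m i j) => //= k ->.
have -> : v = v' + (a *: alpha i + b *: alpha j).
  by rewrite addrA /v' addrAC !subrK.
by rewrite mulmxDr Pmv' mulmxDr -!scalemxAr Pi Pj.
Qed.

End GeometricRepresentation.

(** * Characters and the representation of a Coxeter group *)

Section CoxeterGroup.
Local Open Scope ring_scope.
Variables (R : realType) (n : nat) (W : groupType).
Variables (s : 'I_n -> W) (m : 'I_n -> 'I_n -> nat).
Hypotheses (m_cox : coxeter_matrix m) (W_cox : coxeter_system s m).

Let m_diag i : m i i = 1%N. Proof. by case: m_cox. Qed.
Let m_sym i j : m i j = m j i. Proof. by case: m_cox. Qed.
Let m_neq1 i j : i != j -> m i j != 1%N. Proof. by case: m_cox => _ _; exact. Qed.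

Local Notation alpha := (simple_root R).
Local Notation U i j := (chebU (cox_coef R (m i j))).
Local Notation wprod l := (\prod_(i <- l) s i)%g.

Lemma cox_braid i j : ((s i * s j) ^+ m i j = 1)%g.
Proof. by case: W_cox. Qed.

Lemma cox_ss i : (s i * s i = 1)%g.
Proof. by rewrite -[RHS](cox_braid i i) m_diag expg1. Qed.

Lemma cox_sK (x : W) i : (x * s i * s i = x)%g.
Proof. by rewrite -mulgA cox_ss mulg1. Qed.

Lemma cox_sV i : ((s i)^-1 = s i)%g.
Proof. exact: mulg1_eq (cox_ss i). Qed.

(** Here [bool] with [addb] is Z/2. Relations with an even exponent, 0 included, hold automatically
    there; those with an odd exponent ask for [f i = f j]. *)
Lemma cox_char (f : 'I_n -> bool) : (forall i j, odd (m i j) -> f i = f j) ->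
  exists phi : W -> bool, [/\ phi 1%g = false,
    forall x y, phi (x * y)%g = phi x (+) phi y & forall i, phi (s i) = f i].
Proof.
case: W_cox => _ _ univ hf; apply: univ; first exact: addbA.
- exact: addFb.
- exact: addbF.
move=> i j; have -> k : iter k (addb (f i (+) f j)) false = odd k && (f i (+) f j).
  by elim: k => //= k ->; case: (f i (+) f j); case: (odd k).
by have [/hf ->|//] := boolP (odd (m i j)); rewrite addbb andbF.
Qed.

Lemma cox_rho_ex : exists rho : W -> 'M[R]_n, [/\ rho 1%g = 1%:M,
    forall x y, rho (x * y)%g = rho x *m rho y & forall i, rho (s i) = reflection R m i].
Proof.
case: W_cox => _ _; apply; first exact: mulmxA.
- exact: mul1mx.
- exact: mulmx1.
- by move=> i j; apply: reflection_braid.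
Qed.

Definition rho := projT1 (cid cox_rho_ex).
Lemma rho1 : rho 1%g = 1%:M :> 'M_n. Proof. by rewrite /rho; case: cid => ? []. Qed.
Lemma rhoM (x y : W) : rho (x * y)%g = rho x *m rho y.
Proof. by rewrite /rho; case: cid => ? []. Qed.
Lemma rho_s i : rho (s i) = reflection R m i.
Proof. by rewrite /rho; case: cid => ? []. Qed.

Lemma rhoK (x : W) (v : 'cV_n) : rho x^-1%g *m (rho x *m v) = v.
Proof. by rewrite mulmxA -rhoM mulVg rho1 mul1mx. Qed.

Lemma rhoVK (x : W) (v : 'cV_n) : rho x *m (rho x^-1%g *m v) = v.
Proof. by rewrite mulmxA -rhoM mulgV rho1 mul1mx. Qed.

Lemma rho_s_root i j :
  rho (s i) *m alpha j = alpha j + cox_coef R (m i j) *: alpha i.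
Proof. by rewrite rho_s reflection_root. Qed.

Lemma rho_s_rooti i : rho (s i) *m alpha i = - alpha i.
Proof. by rewrite rho_s reflection_rootii. Qed.

Lemma rho_Ms_root (x : W) i : rho (x * s i)%g *m alpha i = - (rho x *m alpha i).
Proof. by rewrite rhoM -mulmxA rho_s_rooti mulmxN. Qed.

Lemma simple_root_neq0 (i : 'I_n) : alpha i != 0.
Proof. by apply/eqP => /colP /(_ i); rewrite !mxE !eqxx => /eqP; rewrite oner_eq0. Qed.

Lemma root_neq0 (x : W) i : rho x *m alpha i != 0.
Proof.
apply/eqP => /(congr1 (mulmx (rho x^-1%g))); rewrite rhoK mulmx0.
by apply/eqP; exact: simple_root_neq0.
Qed.

(** * Word length and alternating words *)

Lemma cox_word_ex (x : W) : exists k, `[< exists l : seq 'I_n, size l = k /\ x = wprod l >].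
Proof.
by case: W_cox => _ /(_ x) [l ->] _; exists (size l); apply/asboolP; exists l.
Qed.

Definition cox_len (x : W) := ex_minn (cox_word_ex x).
Local Notation len := cox_len.

Lemma reduced_word (x : W) : exists2 l : seq 'I_n, size l = len x & x = wprod l.
Proof. by rewrite /len; case: ex_minnP => k /asboolP [l [? ?]] _; exists l. Qed.

Lemma len_wprod l : (len (wprod l) <= size l)%N.
Proof.
by rewrite /len; case: ex_minnP => k _; apply; apply/asboolP; exists l.
Qed.

Lemma lenM (x y : W) : (len (x * y)%g <= len x + len y)%N.
Proof.
have [l <- ->] := reduced_word x; have [l' <- ->] := reduced_word y.
by rewrite -big_cat -size_cat len_wprod.
Qed.

Lemma len1 : len 1%g = 0%N.
Proof. by have := len_wprod [::]; rewrite big_nil leqn0 => /eqP. Qed.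

Lemma len_s_le i : (len (s i) <= 1)%N.
Proof. by have := len_wprod [:: i]; rewrite big_seq1. Qed.

Lemma lenMs_le (x : W) i : (len (x * s i)%g <= (len x).+1)%N.
Proof.
apply: leq_trans (lenM _ _) _; rewrite -addn1 leq_add2l; exact: len_s_le.
Qed.

Lemma lenMs_ge (x : W) i : (len x <= (len (x * s i)%g).+1)%N.
Proof. by have := lenMs_le (x * s i)%g i; rewrite cox_sK. Qed.

(** The sign character, [true] on every generator, computes the parity of the length, and a further
    generator flips it. *)
Lemma lenMs_neq (x : W) i : len (x * s i)%g != len x.
Proof.
have [phi [phi1 phiM phis]] := @cox_char xpredT (fun _ _ _ => erefl).
have odd_len y : odd (len y) = phi y.
  have [l <- ->] := reduced_word y.
  elim: l => [|j l IH]; first by rewrite big_nil phi1.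
  by rewrite big_cons phiM phis -IH.
apply/eqP => /(congr1 odd); rewrite !odd_len phiM phis.
by case: (phi x).
Qed.

Lemma lenMs_dich (x : W) i : (len x < len (x * s i)%g)%N \/ (len (x * s i)%g < len x)%N.
Proof.
have := lenMs_neq x i; rewrite neq_ltn.
by case/orP; [right | left].
Qed.

Lemma ex_descent (x : W) : x != 1%g -> exists i, (len (x * s i)%g < len x)%N.
Proof.
have [l] := reduced_word x; case/lastP: l => [|l i] sz xE.
  by rewrite xE big_nil eqxx.
move=> _; exists i; rewrite -sz size_rcons ltnS.
by rewrite xE -cats1 big_cat big_seq1 /= cox_sK; exact: len_wprod.
Qed.

(* The word [... i j] of length [k] alternating in [i] and [j] and ending with [j]. *)
Fixpoint alt (i j : 'I_n) (k : nat) : seq 'I_n :=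
  if k is k'.+1 then (if odd k' then i else j) :: alt i j k' else [::].

Lemma size_alt i j k : size (alt i j k) = k.
Proof. by elim: k => //= k ->. Qed.

Lemma altSr i j k : alt j i k.+1 = rcons (alt i j k) i.
Proof.
elim: k => // k IH; rewrite [alt i j k.+1]/= rcons_cons -IH /=.
by case: (odd k).
Qed.

Lemma altD i j a b : exists l, size l = a /\ alt i j (a + b) = l ++ alt i j b.
Proof.
elim: a => [|a [l [sz e]]]; first by exists [::].
by exists ((if odd (a + b) then i else j) :: l); rewrite addSn /= e sz.
Qed.

Lemma wprod_alt_double i j k : wprod (alt i j k.*2) = ((s i * s j) ^+ k)%g.
Proof.
elim: k => [|k IH]; first by rewrite big_nil.
by rewrite doubleS /= !big_cons odd_double /= IH mulgA -expgS.
Qed.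

Lemma wprod_alt_doubleS i j k :
  wprod (alt i j k.*2.+1) = (s j * (s i * s j) ^+ k)%g.
Proof. by rewrite /= big_cons odd_double wprod_alt_double. Qed.

Lemma conj_rot i j k : ((s i * s j) ^+ k * (s j * s i) ^+ k = 1)%g.
Proof.
elim: k => [|k IH]; first by rewrite mulg1.
rewrite expgSr expgS -mulgA [(s i * s j * _)%g]mulgA.
by rewrite (_ : _ * (s j * s i) = 1)%g ?mul1g // mulgA cox_sK cox_ss.
Qed.

(** After multiplication by a power of [s i * s j] this becomes [(s i * s j) ^+ m i j = 1]; the
    parity of [m i j] decides the shape of the words. *)
Lemma wprod_alt_braid i j : wprod (alt i j (m i j)) = wprod (alt j i (m i j)).
Proof.
have := cox_braid i j; set k := m i j; rewrite -[k]odd_double_half.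
case: (odd k); set h := k./2; rewrite ?add0n ?add1n => b.
  rewrite !wprod_alt_doubleS; apply: (mulIg ((s i * s j) ^+ h)%g).
  have Y : ((s j * s i) ^+ h * (s i * s j) ^+ h = 1)%g := conj_rot j i h.
  rewrite -!mulgA Y mulg1 -expgnDr addnn; apply: (mulIg (s i * s j)%g).
  by rewrite -mulgA -expgSr b mulg1 mulgA cox_ss mul1g.
rewrite !wprod_alt_double; apply: (mulIg ((s i * s j) ^+ h)%g).
rewrite -expgnDr addnn b; apply/esym.
exact: conj_rot.
Qed.

Lemma rho_alt_root i j k :
  rho (wprod (alt i j k)) *m alpha i =
  if odd k then U i j k *: alpha i + U i j k.+1 *: alpha j
  else U i j k.+1 *: alpha i + U i j k *: alpha j.
Proof.
elim: k => [|k IH].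
  by rewrite big_nil rho1 mul1mx [odd 0]/= chebU0 chebU1 scale1r scale0r addr0.
rewrite /= big_cons rhoM -mulmxA IH chebUSS.
case: (odd k) => /=; rewrite mulmxDr -!scalemxAr rho_s_rooti rho_s_root.
  rewrite scalerDr scalerN scalerA scalerBl [_ * cox_coef _ _]mulrC.
  by rewrite addrC -addrA addrC.
rewrite (m_sym j i) scalerDr scalerN scalerA scalerBl [_ * cox_coef _ _]mulrC.
by rewrite -addrA.
Qed.

(** The suffix is the longest alternating one that splits off with additive length, so that [v] has
    minimal length in its coset of the dihedral subgroup. *)
Lemma alt_suffix (x : W) i j : (len (x * s j)%g < len x)%N ->
  exists k (v : W), [/\ (0 < k)%N, x = (v * wprod (alt i j k))%g,
    len x = (len v + k)%N, (len v < len (v * s i)%g)%N &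
    (len v < len (v * s j)%g)%N].
Proof.
move=> dj; pose P k := `[< exists v : W, x = (v * wprod (alt i j k))%g /\
  len x = (len v + k)%N >].
have P1 : P 1%N.
  apply/asboolP; exists (x * s j)%g; rewrite /= big_seq1 cox_sK; split=> //.
  by have := lenMs_ge x j; lia.
have bP k : P k -> (k <= len x)%N by case/asboolP => v [_ ->]; lia.
case: (@ex_maxnP P (len x)) => [|//|k /asboolP [v [xE xl]] kmax]; first by exists 1%N.
have k0 : (0 < k)%N by exact: kmax.
exists k, v.
(* A descent of [v] at the letter that continues the alternation would lengthen the suffix. *)
have nxt : (len v < len (v * s (if odd k then i else j))%g)%N.
  set t := if _ then _ else _; case: (lenMs_dich v t) => // lt.
  suff : P k.+1 by move/kmax; rewrite ltnn.
  apply/asboolP; exists (v * s t)%g; rewrite /= big_cons -/t mulgA cox_sK.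
  by split=> //; have := lenMs_ge v t; lia.
(* The other letter is the first one of the suffix; absorbing it into [v] leaves [k - 1] letters,
   and additivity of lengths forces [v] to grow. *)
have prv : (len v < len (v * s (if odd k then j else i))%g)%N.
  case: k k0 xE xl {kmax nxt} => // k _ xE xl.
  rewrite /= big_cons mulgA in xE.
  set t := if odd k then i else j in xE.
  have -> : (if odd k.+1 then j else i) = t by rewrite /= /t; case: (odd k).
  have := lenM (v * s t) (wprod (alt i j k)); rewrite -xE.
  by have := len_wprod (alt i j k); rewrite size_alt; lia.
by split=> //; move: nxt prv; case: (odd k).
Qed.

(** * Signs of roots and descents *)

Definition nonneg (v : 'cV[R]_n) := forall k, 0 <= v k 0.

Lemma nonnegD u v : nonneg u -> nonneg v -> nonneg (u + v).
Proof. by move=> hu hv k; rewrite mxE addr_ge0. Qed.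

Lemma nonnegZ a u : 0 <= a -> nonneg u -> nonneg (a *: u).
Proof. by move=> a0 hu k; rewrite mxE mulr_ge0. Qed.

Lemma nonneg_simple_root (i : 'I_n) : nonneg (alpha i).
Proof. by move=> k; rewrite mxE ler0n. Qed.

(** Induction on the length: split [x] as [v] times an alternating word. The word sends [alpha i] to
    a combination of [alpha i] and [alpha j] with Chebyshev coefficients, and [v] is positive on
    both roots. *)
Theorem root_nonneg (x : W) i : (len x < len (x * s i)%g)%N -> nonneg (rho x *m alpha i).
Proof.
have [k] := ubnP (len x); elim: k => // k IH in x i *; rewrite ltnS => xk ai.
have [->|/ex_descent [j dj]] := eqVneq x 1%g.
  by rewrite rho1 mul1mx; apply: nonneg_simple_root.
have ij : i != j by apply/eqP => e; move: dj; rewrite -e; lia.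
have [h [v [h0 xE xl vi vj]]] := alt_suffix i dj.
have ni : nonneg (rho v *m alpha i) by apply: IH => //; lia.
have nj : nonneg (rho v *m alpha j) by apply: IH => //; lia.
(* If the suffix had length at least [m i j], the braid relation would make it end in [i], and
   [x * s i] would be shorter than [x]. *)
have hm : (m i j == 0)%N || (h < m i j)%N.
  have [//|m0 /=] := eqVneq (m i j) 0%N; rewrite ltnNge; apply/negP => mh.
  have [l [sz e]] := altD i j (h - m i j) (m i j).
  have [h' mE] : exists h', m i j = h'.+1 by exists (m i j).-1; lia.
  have xs : (x * s i = v * wprod (l ++ alt i j h'))%g.
    rewrite xE -[h](subnK mh) e big_cat /= wprod_alt_braid mE altSr -cats1.
    by rewrite !big_cat big_seq1 /= !mulgA cox_sK.
  have := lenM v (wprod (l ++ alt i j h')); rewrite -xs.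
  have := len_wprod (l ++ alt i j h'); rewrite size_cat size_alt sz.
  by lia.
have U0 : 0 <= chebU (cox_coef R (m i j)) h.
  by apply/ltW/chebU_gt0 => //; exact: m_neq1.
(* The index [h.+1] may reach [m i j], where the value is 0. *)
have U1 : 0 <= chebU (cox_coef R (m i j)) h.+1.
  case/orP: hm => hm; first by apply/ltW/chebU_gt0 => //; rewrite ?hm ?m_neq1.
  have [->|ne] := eqVneq h.+1 (m i j).
    by rewrite chebU_period //; have := m_neq1 ij; lia.
  by apply/ltW/chebU_gt0; rewrite ?m_neq1 //; apply/orP; right; lia.
rewrite xE rhoM -mulmxA rho_alt_root.
by case: (odd h); rewrite mulmxDr -!scalemxAr; apply: nonnegD; apply: nonnegZ.
Qed.

Lemma root_nonpos (x : W) i : (len (x * s i)%g < len x)%N -> nonneg (- (rho x *m alpha i)).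
Proof. by move=> h; rewrite -rho_Ms_root; apply: root_nonneg; rewrite cox_sK. Qed.

Lemma nonneg_antisym v : nonneg v -> nonneg (- v) -> v = 0.
Proof.
move=> h h'; apply/colP => k; rewrite mxE; apply/eqP.
by rewrite eq_le h andbT -oppr_ge0; have := h' k; rewrite mxE.
Qed.

Lemma root_nonnegP (x : W) i : nonneg (rho x *m alpha i) -> (len x < len (x * s i)%g)%N.
Proof.
case: (lenMs_dich x i) => // /root_nonpos h' h.
by have := root_neq0 x i; rewrite (nonneg_antisym h h') eqxx.
Qed.

Lemma root_gt0 (x : W) i k : 0 < (rho x *m alpha i) k 0 -> nonneg (rho x *m alpha i).
Proof.
case: (lenMs_dich x i) => [/root_nonneg //|/root_nonpos /(_ k)].
by rewrite [X in 0 <= X]mxE oppr_ge0 => h /lt_le_trans /(_ h); rewrite ltxx.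
Qed.

Lemma root_lt0 (x : W) i k : (rho x *m alpha i) k 0 < 0 -> nonneg (- (rho x *m alpha i)).
Proof.
case: (lenMs_dich x i) => [/root_nonneg /(_ k) h|/root_nonpos //].
by move=> /(le_lt_trans h); rewrite ltxx.
Qed.

Lemma no_descent (x : W) : (forall i, nonneg (rho x *m alpha i)) -> x = 1%g.
Proof.
move=> h; apply/eqP/negPn/negP => /ex_descent [i].
by have := root_nonnegP (h i); lia.
Qed.

Lemma col_basis (v : 'cV[R]_n) : v = \sum_k v k 0 *: alpha k.
Proof.
apply/colP => j; rewrite summxE (bigD1 j) //= !mxE !eqxx mulr1 big1 ?addr0 //.
by move=> k kj; rewrite !mxE eq_sym (negbTE kj) mulr0.
Qed.

Lemma rho_col (x : W) (v : 'cV_n) k :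
  (rho x *m v) k 0 = \sum_j v j 0 * (rho x *m alpha j) k 0.
Proof.
rewrite [in LHS](col_basis v) mulmx_sumr summxE.
by apply: eq_bigr => j _; rewrite -scalemxAr mxE.
Qed.

(** Such an [x] is a longest element: [bnd] bounds all lengths by [len x], and there are finitely
    many words of bounded length. *)
Lemma all_descents_finite (x : W) : (forall i, nonneg (- (rho x *m alpha i))) ->
  finite_set [set: W].
Proof.
move=> hx.
have bnd (y : W) : (len (x * y)%g + len y <= len x)%N.
  have [k] := ubnP (len y); elim: k => // k IH in y *; rewrite ltnS => yk.
  have [->|/ex_descent [i di]] := eqVneq y 1%g; first by rewrite mulg1 len1 addn0.
  have xyA : (x * (y * s i) = x * y * s i)%g := mulgA _ _ _.
  have := IH (y * s i)%g (leq_trans di yk); rewrite xyA.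
  suff : (len (x * y)%g < len (x * y * s i)%g)%N.
    by have := lenMs_ge y i; lia.
  (* [y] makes [alpha i] negative, and [x] makes negative combinations of simple roots positive. *)
  apply: root_nonnegP => j; rewrite rhoM -mulmxA rho_col sumr_ge0 // => h _.
  have := root_nonpos di h; rewrite mxE oppr_ge0 => le1.
  by have := hx h j; rewrite mxE oppr_ge0 => le2; apply: mulr_le0.
pose F (p : {k : 'I_(len x).+1 & k.-tuple 'I_n}) : W := wprod (tagged p).
apply: (@sub_finite_set _ _ (F @` setT)); last exact/finite_image/finite_finset.
move=> y _; have [l sz ->] := reduced_word y.
have lt : (size l < (len x).+1)%N by have := bnd y; lia.
by exists (existT (fun k : 'I__ => k.-tuple 'I_n) (Ordinal lt) (in_tuple l)).
Qed.

Lemma wprodV l : ((wprod l)^-1 = wprod (rev l))%g.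
Proof.
elim: l => [|i l IH]; first by rewrite big_nil invg1.
by rewrite rev_cons -cats1 big_cat big_seq1 big_cons /= invgM IH cox_sV.
Qed.

Lemma lenV (x : W) : len x^-1%g = len x.
Proof.
suff le (y : W) : (len y^-1%g <= len y)%N.
  by apply/eqP; rewrite eqn_leq le -{1}[x]invgK le.
by have [l <- ->] := reduced_word y; rewrite wprodV -(size_rev l) len_wprod.
Qed.

Lemma rho_s_coord i k (v : 'cV_n) : k != i -> (rho (s i) *m v) k 0 = v k 0.
Proof.
move=> ki; rewrite rho_s reflection_mul.
set c := (_ *m v) i 0; by rewrite !mxE (negbTE ki) mulr0 subr0.
Qed.

(** * Involutions of minimal length in their class *)

Lemma short_involution (x : W) : (x * x = 1)%g ->
  (forall g : W, len x <= len (x ^ g)%g)%N ->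
  forall i, (len (x * s i)%g < len x)%N -> rho x *m alpha i = - alpha i.
Proof.
move=> xx xmin i di.
have [b bdef] : exists b, b = - (rho x *m alpha i) by exists (- (rho x *m alpha i)).
have bp : nonneg b by rewrite bdef; apply: root_nonpos.
have xV : (x^-1 = x)%g := mulg1_eq xx.
(* Minimality makes [s i * x * s i] at least as long as [x], hence longer than [s i * x]. As [s i]
   alters only coordinate [i], the vectors [b] and [- s i b] can both be nonnegative only if [b] is
   a multiple of [alpha i]. *)
have sbp : nonneg (- (rho (s i) *m b)).
  rewrite bdef mulmxN opprK mulmxA -rhoM; apply: root_nonneg.
  rewrite -[X in (len X < _)%N]invgK lenV invgM xV cox_sV.
  by apply: leq_trans di _; have := xmin (s i); rewrite conjgE cox_sV mulgA.
have bE : b = b i 0 *: alpha i.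
  apply/colP => k; rewrite !mxE; have [->|ki] := eqVneq k i; first by rewrite mulr1.
  rewrite mulr0; apply/eqP; rewrite eq_le bp andbT.
  by have := sbp k; rewrite mxE oppr_ge0 rho_s_coord.
have xa : rho x *m alpha i = - (b i 0) *: alpha i by rewrite scaleNr -bE bdef opprK.
have : b i 0 ^+ 2 = 1.
  have := congr1 (mulmx (rho x)) xa; rewrite mulmxA -rhoM xx rho1 mul1mx.
  rewrite -scalemxAr xa scalerA mulrNN => /colP /(_ i).
  by rewrite !mxE !eqxx mulr1.
have := bp i; rewrite xa => b0 /eqP; rewrite sqrf_eq1 => /orP[/eqP ->|/eqP e].
  by rewrite scaleN1r.
by move: b0; rewrite e oppr_ge0 ler10.
Qed.

Lemma rho_parabolic (I : pred 'I_n) (l : seq 'I_n) (v : 'cV_n) k :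
  all I l -> ~~ I k -> (rho (wprod l) *m v) k 0 = v k 0.
Proof.
move=> + Ik; elim: l => [_|i l IH /= /andP[Ii Il]].
  by rewrite big_nil rho1 mul1mx.
rewrite big_cons rhoM -mulmxA rho_s_coord ?IH //.
by apply: contraNneq Ik => ->.
Qed.

(* A shortest element of the coset [x W_I] has no descent, hence is trivial. *)
Lemma involution_parabolic (I : pred 'I_n) (x : W) : (x * x = 1)%g ->
  (forall i, I i -> rho x *m alpha i = - alpha i) ->
  (forall i, ~~ I i -> nonneg (rho x *m alpha i)) ->
  exists2 l, all I l & x = wprod l.
Proof.
move=> xx xI xnI.
pose P k := `[< exists2 l, all I l & len (x * wprod l)%g = k >].
have exP : exists k, P k.
  by exists (len x); apply/asboolP; exists [::] => //; rewrite big_nil mulg1.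
case: (ex_minnP exP) => k /asboolP [l Il zk] kmin.
suff z1 : (x * wprod l = 1)%g.
  exists (rev l); first by rewrite all_rev.
  by rewrite -wprodV -[LHS](mulgK (wprod l)) z1 mul1g.
(* Roots indexed by [I] are merely negated by [x], so they contribute nothing to coordinates outside
   [I]. *)
have rho_out (v : 'cV_n) j : ~~ I j ->
    (rho x *m v) j 0 = \sum_(h | ~~ I h) v h 0 * (rho x *m alpha h) j 0.
  move=> Ij; rewrite rho_col (bigID I) /= big1 ?add0r // => h Ih.
  rewrite xI // !mxE (_ : (j == h) = false) ?oppr0 ?mulr0 //.
  by apply/eqP => e; move: Ij; rewrite e Ih.
apply: no_descent => t; have [It|It] := boolP (I t).
  apply: root_nonneg; case: (lenMs_dich (x * wprod l) t) => // lt.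
  suff : (k <= len (x * wprod l * s t)%g)%N by rewrite -zk; lia.
  apply: kmin; apply/asboolP; exists (rcons l t); first by rewrite all_rcons It.
  by rewrite -cats1 big_cat big_seq1 /= mulgA.
(* Otherwise [x] would send [alpha t] into the span of the roots in [I], and then coordinate [t] of
   [x (x alpha_t) = alpha_t] would vanish. *)
have [j Ij j0] : exists2 j, ~~ I j & 0 < (rho x *m alpha t) j 0.
  apply: contrapT => hn.
  have z j : ~~ I j -> (rho x *m alpha t) j 0 = 0.
    move=> Ij; apply/eqP; rewrite eq_le xnI // andbT leNgt; apply/negP => lt.
    by apply: hn; exists j.
  have e : (rho x *m (rho x *m alpha t)) t 0 = 1.
    by rewrite mulmxA -rhoM xx rho1 mul1mx mxE !eqxx.
  move: e; rewrite rho_out // big1 => [/eqP|h Ih]; first by rewrite eq_sym oner_eq0.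
  by rewrite z // mul0r.
apply: (@root_gt0 _ _ j); rewrite rhoM -mulmxA rho_out // (bigD1 t) //=.
rewrite (rho_parabolic _ Il) // mxE !eqxx mul1r big1 ?addr0 // => h /andP[Ih ht].
by rewrite (rho_parabolic _ Il) // mxE (negbTE ht) mul0r.
Qed.

Lemma involution_conj_parabolic (x : W) : infinite_set [set: W] -> (x * x = 1)%g ->
  exists (g : W) (l : seq 'I_n) t, t \notin l /\ (x ^ g)%g = wprod l.
Proof.
move=> inf xx.
have exP : exists k, `[< exists g : W, len (x ^ g)%g = k >].
  by exists (len (x ^ 1)%g); apply/asboolP; exists 1%g.
case: (ex_minnP exP) => k /asboolP [g gk] kmin.
set y := (x ^ g)%g in gk.
have yy : (y * y = 1)%g by rewrite /y -conjMg xx conj1g.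
have ymin (h : W) : (len y <= len (y ^ h)%g)%N.
  by rewrite gk; apply: kmin; apply/asboolP; exists (g * h)%g; rewrite conjgM.
pose I i := (len (y * s i)%g < len y)%N.
have yI i : I i -> rho y *m alpha i = - alpha i by apply: short_involution.
have ynI i : ~~ I i -> nonneg (rho y *m alpha i).
  by move=> Ii; apply: root_nonneg; case: (lenMs_dich y i) => // h; rewrite /I h in Ii.
have [l Il yl] := involution_parabolic yy yI ynI.
have [t It] : exists t, ~~ I t.
  apply: contrapT => hn; apply: inf; apply: (@all_descents_finite y) => i.
  have -> : rho y *m alpha i = - alpha i.
    by apply: yI; apply: contrapT => /negP Ii; apply: hn; exists i.
  by rewrite opprK; apply: nonneg_simple_root.
exists g, l, t; split=> //; apply/negP => /(allP Il).
by rewrite (negbTE It).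
Qed.

(** To be applied to half turns, [t] and [t'] being the vertices off their edges. *)
Lemma not_conj_rotations (x z g : W) t t' : infinite_set [set: W] ->
  (forall i, i != t -> rho x *m alpha i = - alpha i) ->
  (forall i, i != t' -> rho z *m alpha i = - alpha i) ->
  (forall v : 'cV_n, (rho x *m v) t 0 = v t 0) ->
  (forall v : 'cV_n, (rho z *m v) t' 0 = v t' 0) ->
  (forall i, i != t -> s i * x = x * s i)%g ->
  (g * x = z * g)%g -> t = t'.
Proof.
move=> inf xN zN xt zt' xC gx.
have exP : exists k, `[< exists2 h : W, (h * x = z * h)%g & len h = k >].
  by exists (len g); apply/asboolP; exists g.
case: (ex_minnP exP) => k /asboolP [h hx hk] hmin {g gx}.
(* [s i] commutes with [x], so [h * s i] also intertwines [x] and [z] and cannot be shorter than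
   [h]. *)
have hp i : i != t -> nonneg (rho h *m alpha i).
  move=> it; apply: root_nonneg; case: (lenMs_dich h i) => // lt.
  suff : (k <= len (h * s i)%g)%N by rewrite -hk; lia.
  apply: hmin; apply/asboolP; exists (h * s i)%g => //.
  by rewrite -mulgA xC // mulgA hx mulgA.
(* [z] negates [h alpha_i] but preserves its coordinate [t']. *)
have h0 i : i != t -> (rho h *m alpha i) t' 0 = 0.
  move=> it; have := zt' (rho h *m alpha i).
  rewrite mulmxA -rhoM -hx rhoM -mulmxA xN // mulmxN mxE => /eqP.
  by rewrite eq_sym -subr_eq0 opprK -mulr2n mulrn_eq0 /= => /eqP.
have [/root_nonneg ht|/root_nonpos ht] := lenMs_dich h t.
  have h1 : h = 1%g.
    by apply: no_descent => i; have [->|] := eqVneq i t; last exact: hp.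
  apply/eqP/negPn/negP => tt'.
  have := zt' (alpha t'); rewrite -[z]mulg1 -h1 -hx h1 mul1g xN 1?eq_sym //.
  by rewrite !mxE !eqxx => /eqP; rewrite eq_sym -subr_eq0 opprK -natrD pnatr_eq0.
(* Coordinate [t'] cannot vanish on the image of every simple root, because [h] acts invertibly. *)
have htt : (rho h *m alpha t) t' 0 < 0.
  rewrite lt_neqAle; apply/andP; split; last by have := ht t'; rewrite mxE oppr_ge0.
  apply/eqP => e; have : (rho h *m (rho h^-1%g *m alpha t')) t' 0 = 1.
    by rewrite rhoVK mxE !eqxx.
  rewrite rho_col big1 => [/eqP|j _]; first by rewrite eq_sym oner_eq0.
  by have [->|jt] := eqVneq j t; rewrite ?e ?h0 // mulr0.
case: inf; apply: (@all_descents_finite (h * x)) => i.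
have [->|it] := eqVneq i t; last by rewrite rhoM -mulmxA xN // mulmxN opprK; apply: hp.
apply: (@root_lt0 _ _ t'); rewrite rhoM -mulmxA rho_col (bigD1 t) //= xt.
rewrite big1 ?addr0 => [|j jt]; last by rewrite h0 // mulr0.
by rewrite mxE !eqxx mul1r.
Qed.

(** * Dihedral subgroups, their reflections and half turns *)

Lemma rho_rot_root i j k :
  rho ((s i * s j) ^+ k)%g *m alpha i = U i j k.*2.+1 *: alpha i + U i j k.*2 *: alpha j.
Proof. by rewrite -wprod_alt_double rho_alt_root odd_double. Qed.

(** A trivial rotation forces Chebyshev values 1 and 0 at [k.*2.+1] and [k.*2]. For a nonzero
    remainder [r] modulo [m i j] this fails: the value at [r.*2] is nonzero unless [r.*2 = m i j],
    and then the next value is -1. *)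
Lemma rot_order i j k : i != j -> ((s i * s j) ^+ k = 1)%g -> (m i j %| k)%N.
Proof.
move=> ij; have cheb h : ((s i * s j) ^+ h = 1)%g -> U i j h.*2.+1 = 1 /\ U i j h.*2 = 0.
  move=> e; have := rho_rot_root i j h; rewrite e rho1 mul1mx => E; split.
    have := congr1 (fun v : 'cV_n => v i 0) E.
    by rewrite !mxE !eqxx (negbTE ij) mulr0 addr0 mulr1.
  have := congr1 (fun v : 'cV_n => v j 0) E.
  by rewrite !mxE !eqxx eq_sym (negbTE ij) mulr0 add0r mulr1.
have [m0 /cheb [_ /eqP]|m0] := eqVneq (m i j) 0%N.
  by rewrite m0 chebU_cox0 pnatr_eq0 double_eq0 dvd0n.
have m1 : (1 < m i j)%N by have := m_neq1 ij; lia.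
rewrite [k in X in X -> _](divn_eq k (m i j)) expgnDr mulnC expgnA cox_braid expg1n mul1g.
rewrite /dvdn; have := ltn_pmod k (ltnW m1); set r := (k %% _)%N => rm /cheb [c1 c0].
have [//|r0] := eqVneq r 0%N.
have [rlt|] := ltnP r.*2 (m i j).
  have : 0 < U i j r.*2 by apply: chebU_gt0; rewrite ?rlt ?orbT ?m_neq1 //; lia.
  by rewrite c0 ltxx.
move=> le; move: c0 c1; rewrite -[r.*2](subnKC le) -addnS !chebUD_period //.
set q := (r.*2 - m i j)%N.
have [-> _ /eqP|q0] := eqVneq q 0%N.
  by rewrite chebU1 eq_sym -subr_eq0 opprK -mulr2n pnatr_eq0.
have : 0 < U i j q.
  apply: chebU_gt0; rewrite ?m_neq1 ?lt0n //; apply/orP; right.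
  by rewrite /q; lia.
by move=> h /eqP; rewrite oppr_eq0 (gt_eqF h).
Qed.

Lemma rotV i j k : ((s i * s j) ^- k = (s j * s i) ^+ k)%g.
Proof. exact: mulg1_eq (conj_rot i j k). Qed.

Lemma s_rotX i j k : (s i * (s i * s j) ^+ k = (s j * s i) ^+ k * s i)%g.
Proof.
elim: k => [|k IH]; first by rewrite mulg1 mul1g.
by rewrite expgSr mulgA IH expgSr !mulgA !cox_sK.
Qed.

Lemma rot_sX i j k : (s i * (s j * s i) ^+ k = (s i * s j) ^+ k * s i)%g.
Proof.
elim: k => [|k IH]; first by rewrite mulg1 mul1g.
by rewrite expgSr mulgA IH expgSr -!mulgA.
Qed.

(* [s j * s i] is the inverse of [s i * s j], so negative powers are covered. *)
Definition dihedral i j (x : W) :=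
  exists k (e : bool), (x = (s i * s j) ^+ k * (if e then s i else 1) \/
                        x = (s j * s i) ^+ k * (if e then s i else 1))%g.

Lemma dihedral_sl i j (x : W) : dihedral i j x -> dihedral i j (x * s i)%g.
Proof.
move=> [k [e E]]; exists k, (~~ e); case: e E => /=; rewrite ?mulg1.
  by case=> ->; [left | right]; rewrite cox_sK.
by case=> ->; [left | right].
Qed.

Lemma dihedral_sr i j (x : W) : dihedral i j x -> dihedral i j (x * s j)%g.
Proof.
move=> [k [[|] /= [->|->]]]; rewrite ?mulg1.
- by exists k.+1, false; left; rewrite /= mulg1 expgSr mulgA.
- case: k => [|k]; first by exists 1%N, false; left; rewrite /= !mul1g mulg1.
  by exists k, false; right; rewrite /= expgSr !mulgA !cox_sK mulg1.
- case: k => [|k].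
    by exists 1%N, true; right; rewrite /= mul1g cox_sK.
  by exists k, true; left; rewrite /= expgSr mulgA cox_sK.
- by exists k.+1, true; right; rewrite /= expgSr mulgA cox_sK.
Qed.

Lemma dihedral_word i j (l : seq 'I_n) :
  all (fun k => (k == i) || (k == j)) l -> dihedral i j (wprod l).
Proof.
elim/last_ind: l => [|l h IH].
  by exists 0%N, false; left; rewrite big_nil mulg1.
rewrite all_rcons -cats1 big_cat big_seq1 => /andP[/orP[/eqP ->|/eqP ->] /IH].
  exact: dihedral_sl.
exact: dihedral_sr.
Qed.

Definition conjugate (x y : W) := exists g : W, (x ^ g)%g = y.

Lemma conjugate_sym (x y : W) : conjugate x y -> conjugate y x.
Proof. by case=> g <-; exists g^-1%g; rewrite conjgK. Qed.

Lemma conjugate_trans (y x z : W) : conjugate x y -> conjugate y z -> conjugate x z.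
Proof. by case=> g <- [h <-]; exists (g * h)%g; rewrite conjgM. Qed.

(** The word is a palindrome, with middle letter [i] for even [k] and [j] for odd [k]. *)
Lemma conjugate_reflection i j k :
  conjugate ((s i * s j) ^+ k * s i)%g (s i) \/ conjugate ((s i * s j) ^+ k * s i)%g (s j).
Proof.
have cj h (x : W) : (((s i * s j) ^+ h * x * (s j * s i) ^+ h) ^ ((s i * s j) ^+ h) = x)%g.
  rewrite conjgE rotV -!mulgA (conj_rot j i) mulg1 mulgA.
  by rewrite (conj_rot j i) mul1g.
rewrite -[k]odd_double_half; set h := k./2; case: (odd k).
  right; exists ((s i * s j) ^+ h * s i)%g.
  have -> : ((s i * s j) ^+ (true + h.*2) * s i =
             (s i * s j) ^+ h * (s i * s j * s i) * (s j * s i) ^+ h)%g.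
    rewrite -!mulgA rot_sX !mulgA -[(_ * s i * s j)%g]mulgA -expgSr -expgnDr.
    by rewrite add1n -addnn addSn.
  by rewrite conjgM cj conjgE cox_sV !mulgA cox_ss mul1g cox_sK.
left; exists ((s i * s j) ^+ h)%g; rewrite -[RHS](cj h); congr conjg.
by rewrite add0n -addnn expgnDr -!mulgA rot_sX.
Qed.

Lemma conjugate_odd i j : odd (m i j) -> conjugate (s j) (s i).
Proof.
move=> o; exists ((s i * s j) ^+ (m i j)./2)%g.
have := wprod_alt_braid i j; set h := (m i j)./2.
have -> : m i j = h.*2.+1 by rewrite -[LHS]odd_double_half o.
by rewrite !wprod_alt_doubleS conjgE => ->; rewrite rot_sX mulKg.
Qed.

(** For even positive [m i j] this is the rotation by [pi], central in the dihedral subgroup; for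
    [m i j = 0] it is trivial. *)
Definition half_turn i j : W := ((s i * s j) ^+ (m i j)./2)%g.

Lemma half_turn_sqr i j : ~~ odd (m i j) -> (half_turn i j * half_turn i j = 1)%g.
Proof. by move=> e; rewrite -expgnDr addnn even_halfK // cox_braid. Qed.

Lemma half_turnC i j : ~~ odd (m i j) -> half_turn j i = half_turn i j.
Proof.
move=> e; rewrite -(mulg1_eq (half_turn_sqr e)) /half_turn rotV (m_sym i j) //.
Qed.

Lemma half_turn_root i j : i != j -> ~~ odd (m i j) -> m i j != 0%N ->
  rho (half_turn i j) *m alpha i = - alpha i.
Proof.
move=> ij e m0; rewrite rho_rot_root even_halfK //.
have m1 : (1 < m i j)%N by have := m_neq1 ij; lia.
by rewrite chebU_periodS // chebU_period // scale0r addr0 scaleN1r.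
Qed.

Lemma half_turn_comm i j : ~~ odd (m i j) -> (s i * half_turn i j = half_turn i j * s i)%g.
Proof.
move=> e; by rewrite -{2}(half_turnC e) /half_turn (m_sym j i) s_rotX.
Qed.

Lemma half_turn_coord i j k (v : 'cV_n) : k != i -> k != j ->
  (rho (half_turn i j) *m v) k 0 = v k 0.
Proof.
move=> ki kj; rewrite /half_turn -wprod_alt_double.
apply: (@rho_parabolic (fun h => (h == i) || (h == j))); last by rewrite negb_or ki.
by elim: (_.*2) => //= h ->; case: (odd h); rewrite eqxx ?orbT.
Qed.

Lemma neg_root_neq1 (x : W) i : rho x *m alpha i = - alpha i -> x <> 1%g.
Proof.
move=> e x1; move: e; rewrite x1 rho1 mul1mx => /colP /(_ i); rewrite !mxE !eqxx.
by move/eqP; rewrite -subr_eq0 opprK -natrD pnatr_eq0.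
Qed.

(** Reflections are conjugate to a generator. A rotation of exponent [k] and order 2 has [m i j]
    dividing [2 k] but not [k], so [2 k] is an odd multiple [c] of [m i j]. *)
Lemma dihedral_involution i j (x : W) : i != j -> dihedral i j x -> (x * x = 1)%g -> x <> 1%g ->
  [\/ conjugate x (s i), conjugate x (s j) |
      [/\ ~~ odd (m i j), m i j != 0%N & x = half_turn i j]].
Proof.
move=> ij [k [e xE]] xx x1.
have xV : (x^-1 = x)%g := mulg1_eq xx.
case: e xE => [xE|].
  have : conjugate x ((s i * s j) ^+ k * s i)%g.
    case: xE => ->; first by exists 1%g; rewrite conjg1.
    by exists (s i); rewrite -s_rotX conjgE cox_sV !mulgA cox_ss mul1g.
  by case: (conjugate_reflection i j k) => h /conjugate_trans /(_ h);
    [constructor 1 | constructor 2].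
rewrite !mulg1 => xE.
have {xE} : (x = (s i * s j) ^+ k)%g by case: xE => // xE; rewrite -[LHS]xV xE rotV.
move=> xE; move: xx; rewrite xE -expgnDr => /(rot_order ij) /dvdnP [c cE].
constructor 3.
have dvd_x1 : ~ (m i j %| k)%N.
  by move=> /dvdnP [q kE]; apply: x1; rewrite xE kE mulnC expgnA cox_braid expg1n.
have oc : odd c.
  apply: contrapT => /negP oc; apply: dvd_x1; apply/dvdnP; exists c./2.
  by apply: double_inj; rewrite -[k.*2]addnn cE doubleMl even_halfK.
have m2 : ~~ odd (m i j).
  by have := congr1 odd cE; rewrite oddD addbb oddM oc /= => <-.
split=> //.
  by apply/eqP => m0; apply: dvd_x1; rewrite m0 dvd0n; move: cE; rewrite m0; lia.
have -> : k = (m i j * c./2 + (m i j)./2)%N.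
  apply: double_inj; rewrite doubleD even_halfK // -[k.*2]addnn cE.
  by rewrite -{1}[c]odd_double_half oc mulnDl mul1n -doubleMl [(c./2 * _)%N]mulnC addnC.
by rewrite expgnDr expgnA cox_braid expg1n mul1g.
Qed.

End CoxeterGroup.

(** * Groups presented by involutive generators *)

Section PresentationLift.
Variables (X : choiceType) (rels : set (word X)).
Variables (T : Type) (idx : T) (op : T -> T -> T) (f : X -> T).
Hypotheses (opA : associative op) (op1x : left_id idx op) (opx1 : right_id idx op).
Hypothesis ff : forall x, op (f x) (f x) = idx.

(** The sign of a letter is ignored: [ff] makes each image its own inverse, so free reductions are
    respected and [T] needs only a monoid structure. *)
Definition word_eval (w : word X) : T := foldr (fun a t => op (f a.1) t) idx w.

Lemma word_eval_cat u v : word_eval (u ++ v) = op (word_eval u) (word_eval v).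
Proof. by elim: u => [|a u IH] /=; rewrite ?op1x // IH opA. Qed.

Lemma word_eval_exp w k : word_eval (word_exp w k) = iter k (op (word_eval w)) idx.
Proof. by elim: k => //= k IH; rewrite /word_exp /= word_eval_cat IH. Qed.

Lemma presented_group_lift : (forall w, rels w -> word_eval w = idx) ->
  exists phi : presented_group rels -> T, [/\ phi 1%g = idx,
    forall x y, phi (x * y)%g = op (phi x) (phi y)
  & forall w, phi (pres_class rels w) = word_eval w].
Proof.
move=> hrel.
have ev u v : pres_eq rels u v -> word_eval u = word_eval v.
  elim=> {u v} [//|u v _ ->//|u v w _ -> _ ->//|u u' v v' _ e _ e'|x b|w /hrel //].
    by rewrite !word_eval_cat e e'.
  by rewrite /= opx1 ff.
have phiE w : word_eval (repr (pres_class rels w)) = word_eval w.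
  by apply: ev; apply: pres_repr_class.
exists (fun x => word_eval (repr x)); split=> //; first exact: (phiE [::]).
by move=> x y; rewrite [LHS]phiE word_eval_cat.
Qed.

End PresentationLift.

Lemma pres_classX (X : choiceType) (rels : set (word X)) (w : word X) k :
  (pres_class rels w ^+ k)%g = pres_class rels (word_exp w k).
Proof.
elim: k => [//|k IH]; rewrite expgS IH.
exact: pres_mulE.
Qed.

Lemma pres_class_prod (X : choiceType) (rels : set (word X)) (s : X -> presented_group rels) :
  (forall x, s x = pres_class rels (word_gen x)) -> (forall x, s x * s x = 1)%g ->
  forall w, pres_class rels w = (\prod_(a <- w) s a.1)%g.
Proof.
move=> sE ss; elim=> [|[x b] w IH]; first by rewrite big_nil.
rewrite big_cons -IH sE /= (_ : (x, b) :: w = [:: (x, b)] ++ w) // -pres_mulE.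
suff -> : pres_class rels [:: (x, b)] = pres_class rels (word_gen x) by [].
case: b => //.
apply: (mulIg (pres_class rels (word_gen x))); rewrite -sE ss sE.
apply: etrans (pres_mulE _ _ _) _; apply/pres_classP.
exact: (pres_eq_free rels x false).
Qed.

(** * Counting classes by representatives *)

Lemma cc2_is_reps (G : groupType) (T : finType) (P : pred T) (f : T -> G) :
  (forall t, P t -> involution (f t)) ->
  (forall t u, P t -> P u -> conjugate (f t) (f u) -> t = u) ->
  (forall x, involution x -> exists2 t, P t & conjugate x (f t)) ->
  cc2_is G #|P|.
Proof.
move=> finv fsep fsurj.
pose h (k : 'I_#|P|) : set G := conj_class (f (enum_val k)).
rewrite /cc2_is; have -> : involution_classes G = h @` [set: 'I_#|P|].
  apply/seteqP; split=> [_ [x xinv <-]|_ [k _ <-]]; last first.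
    by exists (f (enum_val k)) => //; apply: finv; exact: enum_valP.
  have [t Pt [g xg]] := fsurj x xinv; exists (enum_rank_in Pt t) => //.
  rewrite /h enum_rankK_in //.
  apply/seteqP; split=> _ [y _ <-].
    by exists (g * y)%g => //; rewrite conjgM xg.
  by exists (g^-1 * y)%g => //; rewrite -xg conjgM conjgK.
apply: card_eq_trans (inj_card_eq _) _; last by apply: card_esym; exact: card_II.
move=> k l _ _ e; apply: enum_val_inj; apply: fsep; try exact: enum_valP.
have : h l (f (enum_val l)) by exists 1%g => //; rewrite conjg1.
by rewrite -e => -[g _ <-]; exists g.
Qed.

(** * Triangle groups as Coxeter groups of rank 3 *)

Section TriangleGroup.
Variables p q r : option nat.
Hypotheses (hp : is_exponent p) (hq : is_exponent q) (hr : is_exponent r).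

Local Notation W := (triangle_group p q r).
Local Notation o0 := (@Ordinal 3 0 isT).
Local Notation o1 := (@Ordinal 3 1 isT).
Local Notation o2 := (@Ordinal 3 2 isT).

Lemma I3_ind (P : 'I_3 -> Prop) : P o0 -> P o1 -> P o2 -> forall i, P i.
Proof.
by move=> P0 P1 P2 [[|[|[|//]]] hi]; rewrite (bool_irrelevance hi isT).
Qed.

(* The exponent infinity is encoded as [0]; the edge {i, j} of the triangle has number i + j - 1. *)
Definition triangle_matrix (i j : 'I_3) : nat :=
  if i == j then 1%N else odflt 0%N (nth None [:: p; q; r] (i + j).-1).

Definition triangle_gen (i : 'I_3) : W :=
  pres_class [set` triangle_relators p q r] (word_gen i).

Local Notation m := triangle_matrix.
Local Notation s := triangle_gen.

Lemma triangle_matrixP : coxeter_matrix m.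
Proof.
split=> [i|i j|i j ij]; first by rewrite /m eqxx.
  by rewrite /m eq_sym addnC.
rewrite /m (negbTE ij).
have h (e : option nat) : is_exponent e -> odflt 0%N e != 1%N.
  by case: e => //= k; lia.
by elim/I3_ind: i ij; elim/I3_ind: j => //= _; apply: h.
Qed.

Lemma triangle_relator_class w : w \in triangle_relators p q r ->
  pres_class [set` triangle_relators p q r] w = 1%g.
Proof. by move=> h; apply/pres_classP/pres_eq_rel. Qed.

Lemma triangle_genM i j k : ((s i * s j) ^+ k)%g =
  pres_class [set` triangle_relators p q r] (word_exp (word_gen i ++ word_gen j) k).
Proof. by rewrite -pres_classX; congr (_ ^+ _)%g; apply: pres_mulE. Qed.

Lemma triangle_ss i : (s i * s i = 1)%g.
Proof.
rewrite -[LHS]expg1 triangle_genM; apply: triangle_relator_class.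
by elim/I3_ind: i; rewrite /triangle_relators !inE eqxx ?orbT.
Qed.

Lemma triangle_braid i j : ((s i * s j) ^+ m i j = 1)%g.
Proof.
(* The relators treat each edge in one direction only; conjugation by [s a] reverses it. *)
have mC a b k : ((s a * s b) ^+ k = 1 -> (s b * s a) ^+ k = 1)%g.
  move=> e; have -> : (s b * s a = (s a * s b) ^ (s a))%g.
    by rewrite conjgE !mulgA mulVg mul1g.
  by rewrite -conjXg e conj1g.
have rel a b e : {subset power_relators (word_gen a ++ word_gen b) e <= triangle_relators p q r} ->
    ((s a * s b) ^+ odflt 0%N e = 1)%g.
  case: e => //= k sub; rewrite triangle_genM; apply/triangle_relator_class/sub.
  by rewrite inE.
have r01 : ((s o0 * s o1) ^+ odflt 0%N p = 1)%g.
  by apply: rel => w wp; rewrite !mem_cat wp !orbT.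
have r02 : ((s o0 * s o2) ^+ odflt 0%N q = 1)%g.
  by apply: rel => w wp; rewrite !mem_cat wp !orbT.
have r12 : ((s o1 * s o2) ^+ odflt 0%N r = 1)%g.
  by apply: rel => w wp; rewrite !mem_cat wp !orbT.
elim/I3_ind: i; elim/I3_ind: j; rewrite /m /= ?expg1 ?triangle_ss //; exact: mC.
Qed.

Lemma triangle_system : coxeter_system s m.
Proof.
split; first exact: triangle_braid.
  move=> x; exists (map fst (repr x)); rewrite big_map.
  have := pres_class_prod (s := s) (fun _ => erefl) triangle_ss (repr x).
  by move=> <-; rewrite [RHS]pres_class_repr.
move=> T idx op f opA op1x opx1 ff.
have ss x : op (f x) (f x) = idx by have := ff x x; rewrite /m eqxx /= opx1.
have [|phi [phi1 phiM phiE]] := @presented_group_lift _ [set` triangle_relators p q r] _ idx op f opA op1x opx1 ss.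
  have ev i j : word_eval idx op f (word_gen i ++ word_gen j) = op (f i) (f j).
    by rewrite /= opx1.
  have evg i : word_eval idx op f (word_exp (word_gen i) 2) = idx.
    by rewrite /= opx1.
  have rel i j e : (m i j = odflt 0%N e) -> forall w,
      w \in power_relators (word_gen i ++ word_gen j) e -> word_eval idx op f w = idx.
    case: e => //= k mE w; rewrite inE => /eqP ->.
    by rewrite (word_eval_exp f opA op1x) ev -mE ff.
  move=> w /=; rewrite !inE !mem_cat => /or4P[/eqP ->|/eqP ->|/eqP ->|]; try exact: evg.
  by case/or3P; [apply: (rel o0 o1)|apply: (rel o0 o2)|apply: (rel o1 o2)].
exists phi; split=> // i; rewrite /triangle_gen phiE /= opx1 //.
Qed.

Definition edge_exp (k : 'I_3) : nat := odflt 0%N (nth None [:: p; q; r] k).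
Definition edge_fst (k : 'I_3) : 'I_3 := if k == o2 then o1 else o0.
Definition edge_snd (k : 'I_3) : 'I_3 := if k == o0 then o1 else o2.

Lemma edge_neq k : edge_fst k != edge_snd k.
Proof. by elim/I3_ind: k. Qed.

Lemma edgeE k : m (edge_fst k) (edge_snd k) = edge_exp k.
Proof. by elim/I3_ind: k. Qed.

(** In this numbering edge [k] is opposite to vertex [2 - k], which is [rev_ord k]. *)
Lemma edge_rev k i : i != rev_ord k -> (i == edge_fst k) || (i == edge_snd k).
Proof. by elim/I3_ind: k; elim/I3_ind: i. Qed.

Definition triangle_rep (t : 'I_3 + 'I_3) : W :=
  match t with
  | inl i => s i
  | inr k => half_turn s m (edge_fst k) (edge_snd k)
  end.

(* A generator is kept unless an odd path links it to one of smaller index. *)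
Definition is_triangle_rep (t : 'I_3 + 'I_3) : bool :=
  match t with
  | inl i => nth true [:: true;
      ~~ odd (edge_exp o0) && ~~ (odd (edge_exp o1) && odd (edge_exp o2));
      ~~ odd (edge_exp o1) && ~~ odd (edge_exp o2)] i
  | inr k => (edge_exp k != 0%N) && ~~ odd (edge_exp k)
  end.

Local Open Scope ring_scope.
Local Notation R := (Rdefinitions.R : realType).
Let m_cox := triangle_matrixP.
Let W_cox := triangle_system.

Lemma char_conjugate (phi : W -> bool) (x y : W) :
  (forall a b, phi (a * b)%g = phi a (+) phi b) -> conjugate x y -> phi x = phi y.
Proof.
move=> phiM [g <-]; have := congr1 phi (conjgC x g).
by rewrite !phiM addbC => /addbI.
Qed.

(** A function constant along odd edges extends to a character; in each case the function singles
    out a vertex with no odd edge. *)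
Lemma not_conjugate_gens i j : is_triangle_rep (inl i) -> is_triangle_rep (inl j) ->
  (i < j)%N -> ~ conjugate (s i) (s j).
Proof.
have sep (f : 'I_3 -> bool) (a b : 'I_3) : f a != f b ->
    (odd (edge_exp o0) -> f o0 = f o1) -> (odd (edge_exp o1) -> f o0 = f o2) ->
    (odd (edge_exp o2) -> f o1 = f o2) -> ~ conjugate (s a) (s b).
  move=> fab f0 f1 f2; have hf u v : odd (m u v) -> f u = f v.
    by elim/I3_ind: u; elim/I3_ind: v => //=;
      [move/f0 | move/f1 | move/f2].
  have [phi [phi1 phiM phis]] := cox_char W_cox hf.
  by move/(char_conjugate phiM); rewrite !phis => e; rewrite e eqxx in fab.
elim/I3_ind: i; elim/I3_ind: j => //= _.
- case/andP=> h0; rewrite negb_and => h12 _.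
  (* If the edge from [o0] to [o2] is odd, [o1] is isolated among odd edges; otherwise [o0] is. *)
  have [h1|h1] := boolP (odd (edge_exp o1)).
    rewrite h1 /= in h12; apply: (sep (fun i => i != o1)) => //= h; first by rewrite h in h0.
    by rewrite h in h12.
  apply: (sep (fun i => i == o0)) => //= h; first by rewrite h in h0.
  by rewrite h in h1.
- case/andP=> h1 h2 _; apply: (sep (fun i => i == o2)) => //= h; first by rewrite h in h1.
  by rewrite h in h2.
- case/andP=> h1 h2 _; apply: (sep (fun i => i == o2)) => //= h; first by rewrite h in h1.
  by rewrite h in h2.
Qed.

Lemma gen_rep i : exists2 j, is_triangle_rep (inl j) & conjugate (s i) (s j).
Proof.
have odd_conj a b : odd (m a b) -> conjugate (s a) (s b).
  by move=> h; apply/conjugate_sym/(conjugate_odd m_cox W_cox).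
have crefl (x : W) : conjugate x x by exists 1%g; rewrite conjg1.
have c01 : odd (edge_exp o0) -> conjugate (s o1) (s o0) := odd_conj o1 o0.
have c02 : odd (edge_exp o1) -> conjugate (s o2) (s o0) := odd_conj o2 o0.
have c12 : odd (edge_exp o2) -> conjugate (s o1) (s o2) := odd_conj o1 o2.
have c1 : exists2 j, is_triangle_rep (inl j) & conjugate (s o1) (s j).
  have [/c01 h|h0] := boolP (odd (edge_exp o0)); first by exists o0.
  have [/andP[/c02 h1 /c12 h2]|h] := boolP (odd (edge_exp o1) && odd (edge_exp o2)).
    by exists o0 => //; apply: conjugate_trans h2 h1.
  by exists o1; rewrite //= h0 h.
elim/I3_ind: i => //; first by exists o0.
have [/c02 h|h1] := boolP (odd (edge_exp o1)); first by exists o0.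
have [/c12 h|h2] := boolP (odd (edge_exp o2)).
  by have [j jr jc] := c1; exists j => //; apply: conjugate_trans jc; apply: conjugate_sym.
by exists o2; rewrite //= h1 h2.
Qed.

Lemma half_turn_edge k : is_triangle_rep (inr k) ->
  forall i, i != rev_ord k ->
  rho R m_cox W_cox (triangle_rep (inr k)) *m simple_root R i = - simple_root R i.
Proof.
move=> /andP[k0 ke] i /edge_rev /orP[/eqP ->|/eqP ->].
  by apply: half_turn_root; rewrite ?edge_neq ?edgeE.
rewrite /= -(half_turnC m_cox W_cox) ?edgeE //.
have mC : m (edge_snd k) (edge_fst k) = edge_exp k by rewrite -edgeE; case: m_cox.
by apply: half_turn_root; rewrite ?mC // eq_sym edge_neq.
Qed.

Hypothesis hinf : infinite_set [set: W].

Lemma triangle_cc2 : cc2_is W #|is_triangle_rep|.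
Proof.
have edge_even k : is_triangle_rep (inr k) -> ~~ odd (m (edge_fst k) (edge_snd k)).
  by rewrite edgeE => /andP[].
apply: (cc2_is_reps (f := triangle_rep)).
- move=> [i|k] tr; split; rewrite ?expg2.
  + by apply: (neg_root_neq1 (R := R) (m_cox := m_cox) (W_cox := W_cox)); apply: rho_s_rooti.
  + exact: triangle_ss.
  + apply: (neg_root_neq1 (R := R) (m_cox := m_cox) (W_cox := W_cox) (i := edge_fst k)).
    by apply: half_turn_edge => //; elim/I3_ind: k {tr}.
  + by apply: (half_turn_sqr W_cox); apply: edge_even.
(* The sign character is [true] on generators and [false] on half turns, words of even length. *)
- have [phi [phi1 phiM phis]] := @cox_char _ _ _ _ W_cox xpredT (fun _ _ _ => erefl).
  have phi_turn k : phi (triangle_rep (inr k)) = false.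
    rewrite /= /half_turn; elim: (_./2) => //= h IH.
    by rewrite expgS phiM IH phiM !phis.
  move=> [i|k] [j|l] Pi Pj c.
  + case: (ltngtP i j) => [ij|ji|/val_inj -> //].
      by case: (not_conjugate_gens Pi Pj ij).
    by case: (not_conjugate_gens Pj Pi ji); apply: conjugate_sym.
  + by have := char_conjugate phiM c; rewrite phi_turn /= phis.
  + by have := char_conjugate phiM c; rewrite phi_turn /= phis.
  (* Two half turns are compared through the vertices opposite to their edges. *)
  + case: c => g gE; congr inr; apply: rev_ord_inj.
    apply: (@not_conj_rotations R _ _ _ _ m_cox W_cox (triangle_rep (inr k)) (triangle_rep (inr l)) (g^-1)%g) => //.
    * exact: half_turn_edge.
    * exact: half_turn_edge.
    * by move=> v; apply: half_turn_coord; elim/I3_ind: k {Pi gE}.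
    * by move=> v; apply: half_turn_coord; elim/I3_ind: l {Pj gE}.
    * move=> i /edge_rev /orP[/eqP ->|/eqP ->].
        by apply: (half_turn_comm m_cox W_cox); apply: edge_even.
      rewrite /= -(half_turnC m_cox W_cox) ?edge_even //.
      apply: (half_turn_comm m_cox W_cox).
      by have := edge_even _ Pi; case: m_cox => _ ->.
    * by rewrite -gE conjgE -[in RHS]mulgA -[in RHS]mulgA mulgV mulg1.
move=> x [x1]; rewrite expg2 => xx.
have [g [l [t [tl xg]]]] := @involution_conj_parabolic R _ _ _ _ m_cox W_cox x hinf xx.
(* The conjugate avoids the letter [t], so it lies in the dihedral subgroup of the edge opposite to
   [t]. *)
pose k := rev_ord t.
have dih : dihedral s (edge_fst k) (edge_snd k) (x ^ g)%g.
  rewrite xg; apply: (dihedral_word m_cox W_cox); apply/allP => i il.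
  by apply: edge_rev; rewrite /k rev_ordK; apply: contraNneq tl => <-.
have gg : (x ^ g * x ^ g = 1)%g by rewrite -conjMg xx conj1g.
have g1 : (x ^ g <> 1)%g.
  by move=> e; apply: x1; apply/eqP; rewrite -(conjg_eq1 x g) e.
have xc : conjugate x (x ^ g)%g by exists g.
have gen i : conjugate (x ^ g)%g (s i) -> exists2 u, is_triangle_rep u & conjugate x (triangle_rep u).
  move=> c; have [j jr jc] := gen_rep i; exists (inl j) => //.
  exact: conjugate_trans xc (conjugate_trans c jc).
have [|c|[me m0 xE]] := dihedral_involution R m_cox W_cox (edge_neq k) dih gg g1; first exact: gen.
  exact: gen c.
exists (inr k); first by rewrite /= -edgeE m0 me.
by rewrite /= -xE.
Qed.

Lemma card_triangle_rep : #|is_triangle_rep| =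
  (1 + (~~ odd (edge_exp o0) && ~~ (odd (edge_exp o1) && odd (edge_exp o2)))
     + (~~ odd (edge_exp o1) && ~~ odd (edge_exp o2))
   + (((edge_exp o0 != 0) && ~~ odd (edge_exp o0)) + ((edge_exp o1 != 0) && ~~ odd (edge_exp o1))
     + ((edge_exp o2 != 0) && ~~ odd (edge_exp o2))))%N.
Proof.
rewrite -sum1_card big_sumType /= !big_mkcond /= !big_ord_recl !big_ord0 /=.
rewrite big_mkcond !big_ord_recl big_ord0 /in_mem /= /edge_exp /= !addn0 -!addnA.
by do !case: ifP.
Qed.

End TriangleGroup.

(** * Evaluation of the count by parities *)

Theorem mainTheorem9 (p q r : option nat)
    (hp : is_exponent p) (hq : is_exponent q) (hr : is_exponent r)
    (hinf : infinite_set [set: triangle_group p q r]) :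
  [/\ forall a b c : nat, p = Some a -> q = Some b -> r = Some c ->
        [/\ ~~ odd a /\ ~~ odd b /\ ~~ odd c -> cc2_is (triangle_group p q r) 6,
            odd a /\ odd b /\ odd c -> cc2_is (triangle_group p q r) 1,
            count odd [:: a; b; c] = 1 -> cc2_is (triangle_group p q r) 4
          & count (predC odd) [:: a; b; c] = 1 ->
              cc2_is (triangle_group p q r) 2],
      forall b c : nat, p = None -> q = Some b -> r = Some c ->
        [/\ ~~ odd b /\ ~~ odd c -> cc2_is (triangle_group p q r) 5,
            odd b /\ odd c -> cc2_is (triangle_group p q r) 1
          & odd (b + c) -> cc2_is (triangle_group p q r) 3],
      forall c : nat, p = None -> q = None -> r = Some c ->
        [/\ ~~ odd c -> cc2_is (triangle_group p q r) 4
          & odd c -> cc2_is (triangle_group p q r) 2]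
    & p = None -> q = None -> r = None -> cc2_is (triangle_group p q r) 3].
Proof.
have := triangle_cc2 hp hq hr hinf; rewrite card_triangle_rep /edge_exp /=.
move=> cc; split.
- move=> a b c ea eb ec; rewrite {}ea {}eb {}ec /= in hp hq hr cc *.
  (* Finite exponents exceed 1, so none is mistaken for the code 0 of infinity, and the count
     depends on parities alone. *)
  have [a0 b0 c0] : [/\ a != 0, b != 0 & c != 0]%N by split; lia.
  rewrite a0 b0 c0 /= {a0 b0 c0} in cc.
  by move: cc; case: (odd a); case: (odd b); case: (odd c) => /= cc;
    split=> // -[? [? ?]].
- move=> b c ea eb ec; rewrite {}ea {}eb {}ec /= in hp hq hr cc *.
  have [b0 c0] : b != 0%N /\ c != 0%N by split; lia.
  rewrite b0 c0 oddD /= {b0 c0} in cc *.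
  by move: cc; case: (odd b); case: (odd c) => /= cc; split=> // -[? ?].
- move=> c ea eb ec; rewrite {}ea {}eb {}ec /= in hp hq hr cc *.
  have c0 : c != 0%N by lia.
  rewrite c0 /= {c0} in cc.
  by move: cc; case: (odd c) => /= cc; split.
by move=> ea eb ec; move: cc; rewrite ea eb ec.
Qed.
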